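(* Let $k,l\ge 2$, $n,m\ge1$ be integers, $\alpha>0$, and suppose $f=(f_1,\dots,f_m):\mathbb{Z}_k^n\to\mathbb{Z}_l^m$ is $\alpha$-Lipschitz with respect to the $L^1$-norm. Then for any $\delta,\epsilon>0$, there are at least $(1-\delta)m$ coordinates $i\in[m]$ such that $f_i$ is $\epsilon$-close to some $M$-junta $g_i:\mathbb{Z}_k^n\to\mathbb{Z}_l$, where $$M\le l\exp\!\left(\frac{C_2\alpha k}{\delta\epsilon}\right)$$ and $C_2$ is an absolute constant.
   Context: For $s\in\mathbb{Z}_q$, $|s|'$ denotes the cyclic distance from $s$ to $0$ in $\mathbb{Z}_q$. For $x\in\mathbb{Z}_k^n$, $\|x\|_1=\frac1n\sum_{i=1}^n|x_i|'$, and similarly for $y\in\mathbb{Z}_l^m$, $\|y\|_1=\frac1m\sum_{i=1}^m|y_i|'$. $f$ is $\alpha$-Lipschitz with respect to the $L^1$-norm if $\|f(x)-f(y)\|_1\le\alpha\|x-y\|_1$ for all $x,y\in\mathbb{Z}_k^n$. Two functions $h,\tilde h:\mathbb{Z}_k^n\to\mathbb{Z}_l$ are $\epsilon$-close if $k^{-n}\sum_{x\in\mathbb{Z}_k^n}|h(x)-\tilde h(x)|'\le\epsilon$. A function $g$ on $\mathbb{Z}_k^n$ is an $M$-junta if there is $J\subset[n]$ with $|J|=M$ such that $g(x)$ depends only on $(x_j)_{j\in J}$. *)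

(* Defs.v *)
From mathcomp Require Import all_boot all_order all_algebra.
From mathcomp Require Import reals.

Set Implicit Arguments.
Unset Strict Implicit.
Unset Printing Implicit Defensive.

Import Order.TTheory GRing.Theory Num.Theory.
Local Open Scope ring_scope.

(* ['Z_q] is the ring of integers mod q only for 1 < q: every use of the
   definitions below is meant under this hypothesis. *)

(* The canonical representative s of a residue class satisfies 0 <= s < q. *)
Definition cyc_abs (q : nat) (s : 'Z_q) : nat := minn s (q - s).

Definition norm1 (R : realType) (q n : nat) (x : 'rV['Z_q]_n) : R :=
  n%:R^-1 * \sum_(i < n) (cyc_abs (x 0 i))%:R.

Definition lipschitz1 (R : realType) (k l n m : nat) (alpha : R)
    (f : 'rV['Z_k]_n -> 'rV['Z_l]_m) : Prop :=
  forall x y : 'rV['Z_k]_n, norm1 R (f x - f y) <= alpha * norm1 R (x - y).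

Definition eps_close (R : realType) (k l n : nat) (eps : R)
    (h h' : 'rV['Z_k]_n -> 'Z_l) : Prop :=
  (k%:R ^+ n)^-1 * \sum_(x : 'rV['Z_k]_n) (cyc_abs (h x - h' x))%:R <= eps.

Definition junta (k n : nat) (T : Type) (M : nat) (g : 'rV['Z_k]_n -> T) :
    Prop :=
  exists J : {set 'I_n}, #|J| = M /\
    forall x y : 'rV['Z_k]_n, {in J, forall j, x 0 j = y 0 j} -> g x = g y.

(* Main.v *)
Require Import Defs.
From mathcomp Require Import all_boot all_order all_algebra.
From mathcomp Require Import reals sequences exp.
From mathcomp Require Import ring lra zify.

Set Implicit Arguments.
Unset Strict Implicit.
Unset Printing Implicit Defensive.

Import Order.TTheory GRing.Theory Num.Theory.
Local Open Scope ring_scope.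

(** Summing the Lipschitz condition over all edges of the torus bounds the
    average over i of the total variation of f_i, so by Markov's inequality a
    fraction 1 - delta of the f_i have total variation at most k alpha / delta.
    Such a function h is cut by the l rotated half circles into Boolean functions
    h_t; the number of t separating a from b lies between |a - b|' and 2 |a - b|',
    so both the variation of h and its distance to a junta are controlled by sums
    over t.

    For the Boolean functions, a Friedgut-type theorem is proved as in Falik and
    Samorodnitsky: the log-Sobolev inequality is applied to the martingale
    differences obtained by averaging out, one at a time, the coordinates of small
    influence.  The Dirichlet form must satisfy a log-Sobolev inequality on Z_k
    with an absolute constant and be O(1) times the number of boundary edges on
    Boolean functions; such a form comes from a balanced binary tree on
    {0, ..., k - 1}.  Finally h is compared with h(x_J, z) for one good choice of
    the frozen coordinates z. *)

(** * Entropy and the Cauchy-Schwarz inequality *)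

Section Entropy.
Variable R : realType.
Implicit Types a b m p q u v : R.

Definition xlnx a : R := a * ln a.

Lemma xlnx0 : xlnx 0 = 0. Proof. by rewrite /xlnx mul0r. Qed.

Lemma xlnx_le a m : 0 <= a -> 0 < m ->
  xlnx a <= a * ln m + a * (a / m - 1).
Proof.
rewrite le0r => /predU1P[->|a0 m0]; first by rewrite xlnx0 !mul0r addr0.
rewrite -mulrDr ler_pM2l// -lerBlDl -ln_div ?posrE//.
have h : -1 < a / m - 1 by rewrite ltrBrDr addNr divr_gt0.
by have := le_ln1Dx h; rewrite addrC subrK.
Qed.

(** The bound [ln u^-1 <= u^-1 - 1] makes the loss linear in [|u|], so negative entropy terms are
    controlled by an L1 norm. *)
Lemma xlnx_sqr_ge u : - 2 * `|u| <= xlnx (u ^+ 2).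
Proof.
rewrite -real_normK ?num_real//; have := normr_ge0 u; move: `|u| => {}u.
rewrite le0r => /predU1P[->|u0]; first by rewrite expr0n/= xlnx0 mulr0.
rewrite /xlnx lnXn// -[ln u]opprK -lnV ?posrE//.
have h : -1 < u^-1 - 1 by rewrite ltrBrDr addNr invr_gt0.
have := le_ln1Dx h; rewrite addrC subrK => h1.
have h2 : u ^+ 2 * ln u^-1 <= u ^+ 2 * (u^-1 - 1).
  by rewrite ler_pM2l// exprn_gt0.
have h3 : u ^+ 2 * u^-1 = u by field; rewrite gt_eqF.
rewrite mulrnAr mulr2n mulrN.
have := sqr_ge0 u; rewrite mulrBr h3 in h2.
lra.
Qed.

(* Replacing [ln] by its linear upper bound turns the entropy into
   variance over mean, which is dominated by [(p + q) (u - v)^2] without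
   any dependence on the ratio p : q. *)
Lemma two_point_entropy p q u v : 0 < p -> 0 < q -> 0 <= u -> 0 <= v ->
  p * xlnx (u ^+ 2) + q * xlnx (v ^+ 2)
    - (p + q) * xlnx ((p * u ^+ 2 + q * v ^+ 2) / (p + q))
  <= (p + q) * (u - v) ^+ 2.
Proof.
move=> p0 q0 u0 v0.
have s0 : 0 < p + q by rewrite addr_gt0.
set m := (_ / _).
have ms : (p + q) * m = p * u ^+ 2 + q * v ^+ 2.
  by rewrite /m mulrC divfK// gt_eqF.
have pu : 0 <= p * u ^+ 2 by rewrite mulr_ge0 ?sqr_ge0// ltW.
have qv : 0 <= q * v ^+ 2 by rewrite mulr_ge0 ?sqr_ge0// ltW.
have [m0|m0] := eqVneq m 0.
  move: ms; rewrite m0 mulr0 => /esym/eqP.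
  rewrite paddr_eq0// !mulf_eq0 (gt_eqF p0) (gt_eqF q0)/= !orbb.
  move=> /andP[/eqP-> /eqP->].
  by rewrite expr0n/= xlnx0 subrr expr0n/= !mulr0 addr0 subr0.
have {m0} mp : 0 < m.
  by rewrite lt0r m0/= /m divr_ge0 ?addr_ge0// ltW.
have h1 := xlnx_le (sqr_ge0 u) mp.
have h2 := xlnx_le (sqr_ge0 v) mp.
have h1' := ler_wpM2l (ltW p0) h1.
have h2' := ler_wpM2l (ltW q0) h2.
apply: (@le_trans _ _ (p * (u ^+ 2 * (u ^+ 2 / m - 1)) +
   q * (v ^+ 2 * (v ^+ 2 / m - 1)))).
  rewrite {3}/xlnx mulrA ms; lra.
rewrite -(ler_pM2r mp) -(ler_pM2l s0).
have -> : (p + q) * ((p * (u ^+ 2 * (u ^+ 2 / m - 1)) +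
   q * (v ^+ 2 * (v ^+ 2 / m - 1))) * m) = p * q * (u ^+ 2 - v ^+ 2) ^+ 2.
  rewrite -[LHS]/((p + q) * ((p * (u ^+ 2 * (u ^+ 2 / m - 1)) +
   q * (v ^+ 2 * (v ^+ 2 / m - 1))) * m)).
  transitivity ((p + q) * (p * u ^+ 4 + q * v ^+ 4) -
    ((p + q) * m) * (p * u ^+ 2 + q * v ^+ 2)).
    by field; rewrite gt_eqF.
  by rewrite ms; ring.
have -> : (p + q) * ((p + q) * (u - v) ^+ 2 * m) =
   (p + q) * (p * u ^+ 2 + q * v ^+ 2) * (u - v) ^+ 2 by rewrite -ms; ring.
(* With denominators cleared, the two sides differ by a perfect square. *)
rewrite -subr_ge0.
have -> : (p + q) * (p * u ^+ 2 + q * v ^+ 2) * (u - v) ^+ 2 -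
   p * q * (u ^+ 2 - v ^+ 2) ^+ 2 = ((p * u - q * v) * (u - v)) ^+ 2 by ring.
exact: sqr_ge0.
Qed.

(** Lagrange's identity writes twice the Cauchy-Schwarz defect as a sum of squares. *)
Lemma sum_mul_le (I : finType) (u v : I -> R) :
  \sum_i u i * v i <=
  Num.sqrt (\sum_i u i ^+ 2) * Num.sqrt (\sum_i v i ^+ 2).
Proof.
set A := \sum_i u i ^+ 2; set B := \sum_i v i ^+ 2; set C := \sum_i _.
have A0 : 0 <= A by apply: sumr_ge0 => i _; exact: sqr_ge0.
have B0 : 0 <= B by apply: sumr_ge0 => i _; exact: sqr_ge0.
have h : 0 <= \sum_i \sum_j (u i * v j - u j * v i) ^+ 2.
  by apply: sumr_ge0 => i _; apply: sumr_ge0 => j _; exact: sqr_ge0.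
have : \sum_i \sum_j (u i * v j - u j * v i) ^+ 2 = 2 * (A * B - C ^+ 2).
  have -> : 2 * (A * B - C ^+ 2) = A * B + B * A - 2 * (C * C) by ring.
  rewrite /A /B /C !big_distrlr/= mulr_sumr -big_split -sumrB/=.
  apply: eq_bigr => i _; rewrite mulr_sumr -big_split -sumrB/=.
  by apply: eq_bigr => j _; ring.
move=> E; rewrite E in h.
have hC : C ^+ 2 <= A * B by lra.
rewrite -sqrtrM//; apply: le_trans (ler_norm _) _.
by rewrite -sqrtr_sqr ler_wsqrtr.
Qed.

(** Reverse triangle inequality for the L2 norm with constant weight [c]. *)
Lemma sqrt_sum_sub (I : finType) (c : R) (u v : I -> R) : 0 <= c ->
  (Num.sqrt (c * \sum_i u i ^+ 2) - Num.sqrt (c * \sum_i v i ^+ 2)) ^+ 2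
  <= c * \sum_i (u i - v i) ^+ 2.
Proof.
move=> c0; rewrite !sqrtrM// -mulrBr exprMn sqr_sqrtr// ler_wpM2l//.
have h := sum_mul_le u v.
have A0 : 0 <= \sum_i u i ^+ 2 by apply: sumr_ge0 => i _; exact: sqr_ge0.
have B0 : 0 <= \sum_i v i ^+ 2 by apply: sumr_ge0 => i _; exact: sqr_ge0.
have -> : \sum_i (u i - v i) ^+ 2 =
   \sum_i u i ^+ 2 + \sum_i v i ^+ 2 - 2 * \sum_i u i * v i.
  rewrite mulr_sumr -big_split -sumrB/=.
  by apply: eq_bigr => i _; ring.
rewrite sqrrB !sqr_sqrtr//; lra.
Qed.

(** The reverse triangle inequality on the product of the two index sets, where [g] and [h] depend
    on different factors. *)
Lemma sum_sqr_sub_le (p q : nat) (g : nat -> R) (h : nat -> R) :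
    (0 < p)%N -> (0 < q)%N ->
  (Num.sqrt (p%:R^-1 * \sum_(i < p) g i ^+ 2) -
   Num.sqrt (q%:R^-1 * \sum_(i < q) h i ^+ 2)) ^+ 2 <=
  (p%:R * q%:R)^-1 * \sum_(i < p) \sum_(j < q) (g i - h j) ^+ 2.
Proof.
move=> p0 q0; have p0' : p%:R != 0 :> R by rewrite pnatr_eq0 -lt0n.
have q0' : q%:R != 0 :> R by rewrite pnatr_eq0 -lt0n.
have c0 : 0 <= (p%:R * q%:R)^-1 :> R by rewrite invr_ge0 mulr_ge0.
have := @sqrt_sum_sub ('I_p * 'I_q)%type _
  (fun x => g x.1) (fun x => h x.2) c0.
have E (F : nat -> nat -> R) : \sum_(x : 'I_p * 'I_q) F x.1 x.2 =
   \sum_(i < p) \sum_(j < q) F i j by rewrite pair_bigA.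
rewrite (E (fun i _ => g i ^+ 2)) (E (fun _ j => h j ^+ 2)).
rewrite (E (fun i j => (g i - h j) ^+ 2)).
have -> : (p%:R * q%:R)^-1 * (\sum_(i < p) \sum_(j < q) g i ^+ 2) =
    p%:R^-1 * \sum_(i < p) g i ^+ 2.
  rewrite [in RHS]mulr_sumr mulr_sumr; apply: eq_bigr => i _.
  by rewrite sumr_const card_ord -mulr_natl; field; rewrite p0' q0'.
have -> : (p%:R * q%:R)^-1 * (\sum_(i < p) \sum_(j < q) h j ^+ 2) =
    q%:R^-1 * \sum_(i < q) h i ^+ 2; last by [].
by rewrite sumr_const card_ord -mulr_natl; field; rewrite p0' q0'.
Qed.

End Entropy.

(** * A log-Sobolev inequality on an interval *)

Definition flips (n : nat) (h : nat -> bool) : nat :=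
  (\sum_(c < n) (h c (+) h c.+1))%N.

Lemma addb_le_flips (n a b : nat) (h : nat -> bool) :
  (a <= n)%N -> (b <= n)%N -> ((h a (+) h b) <= flips n h)%N.
Proof.
rewrite /flips; elim: n => [|n IH] in a b *.
  by rewrite !leqn0 => /eqP-> /eqP->; rewrite addbb.
rewrite big_ord_recr/= leq_eqVlt => /predU1P[->|an].
  rewrite leq_eqVlt => /predU1P[->|bn]; first by rewrite addbb.
  have := IH n b (leqnn n) bn.
  by case: (h n); case: (h b); case: (h n.+1) => /=; lia.
rewrite leq_eqVlt => /predU1P[->|bn]; last exact: leq_trans (IH _ _ an bn) (leq_addr _ _).
have := IH a n an (leqnn n).
by case: (h n); case: (h a); case: (h n.+1) => /=; lia.
Qed.

Lemma flipsD (p q : nat) (h : nat -> bool) :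
  flips (p.+1 + q) h =
  (flips p h + (h p (+) h p.+1) + flips q (fun i => h (p.+1 + i)))%N.
Proof.
rewrite /flips big_split_ord big_ord_recr/=; congr addn.
by apply: eq_bigr => i _; rewrite addnS.
Qed.

(* The weights come from a balanced binary tree on the interval: at each
   node the two halves are compared through the product coupling.  A flip of [h]
   is felt only at its ancestors, whose sizes decay geometrically. *)
Lemma interval_log_sobolev (R : realType) (k : nat) : (0 < k)%N ->
  exists w : nat -> nat -> R,
  [/\ forall a b, 0 <= w a b,
      forall g : nat -> R,
        \sum_(i < k) xlnx (g i ^+ 2)
          - k%:R * xlnx (k%:R^-1 * \sum_(i < k) g i ^+ 2)
        <= \sum_(a < k) \sum_(b < k) w a b * (g a - g b) ^+ 2 &
      forall h : nat -> bool,
        \sum_(a < k) \sum_(b < k) w a b * (h a (+) h b)%:R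
        <= 3 * k%:R * (flips k.-1 h)%:R].
Proof.
elim/ltn_ind: k => -[//|[|k]] IH _.
  exists (fun _ _ => 0); split => // [g|h].
    by rewrite !big_ord1 invr1 !mul1r mul0r subrr.
  by rewrite !big_ord1 mul0r !mulr_ge0.
(* Blocks of at most two thirds of the total size let the constant 3 reproduce itself in the flip
   bound. *)
have [p' [q' [kE p3 q3]]] : exists p' q' : nat, [/\ k.+2 = (p'.+1 + q'.+1)%N,
    (3 * p'.+1 <= 2 * k.+2)%N & (3 * q'.+1 <= 2 * k.+2)%N].
  by exists (k.+2)./2.-1, (k.+2 - (k.+2)./2).-1; split; lia.
rewrite {}kE in p3 q3 IH *.
have [w1 [w1ge w1ls w1fl]] := IH p'.+1 ltac:(lia) isT.
have [w2 [w2ge w2ls w2fl]] := IH q'.+1 ltac:(lia) isT.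
set p := p'.+1 in p3 q3 w1ls w1fl *; set q := q'.+1 in p3 q3 w2ls w2fl *.
have p0 : 0 < p%:R :> R by rewrite ltr0n.
have q0 : 0 < q%:R :> R by rewrite ltr0n.
have pq0 : 0 < (p%:R * q%:R)^-1 :> R by rewrite invr_gt0 mulr_gt0.
(* This factor turns the sum over cross pairs, each taken in one order only, into [p + q] times its
   mean. *)
set c : R := (p%:R + q%:R) * (p%:R * q%:R)^-1.
have c0 : 0 <= c by rewrite mulr_ge0 ?addr_ge0 ?ltW.
pose w a b := if (a < p)%N then if (b < p)%N then w1 a b else c
   else if (b < p)%N then 0 else w2 (a - p)%N (b - p)%N.
have wE (F : nat -> nat -> R) :
   \sum_(a < p + q) \sum_(b < p + q) w a b * F a b =
   \sum_(a < p) \sum_(b < p) w1 a b * F a b +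
   c * \sum_(a < p) \sum_(b < q) F a (p + b)%N +
   \sum_(a < q) \sum_(b < q) w2 a b * F (p + a)%N (p + b)%N.
  rewrite big_split_ord/= mulr_sumr -big_split/=; congr +%R.
    apply: eq_bigr => a _; rewrite big_split_ord/= mulr_sumr /w ltn_ord.
    congr +%R; first by apply: eq_bigr => b _; rewrite ltn_ord.
    by apply: eq_bigr => b _; rewrite ltnNge leq_addr.
  apply: eq_bigr => a _; rewrite big_split_ord/= /w ltnNge leq_addr/=.
  rewrite big1 ?add0r => [|b _]; last by rewrite ltn_ord mul0r.
  by apply: eq_bigr => b _; rewrite ltnNge leq_addr/= !addKn.
exists w; split.
- by move=> a b; rewrite /w; case: ifP => _; case: ifP.
- move=> g; rewrite (wE (fun a b => (g a - g b) ^+ 2)) !big_split_ord/=.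
  have := w1ls g; have := w2ls (fun i => g (p + i)%N); rewrite /=.
  have := sum_sqr_sub_le g (fun i => g (p + i)%N) (ltn0Sn p') (ltn0Sn q').
  rewrite -/p -/q; set A := p%:R^-1 * _; set B := q%:R^-1 * _ => hs.
  have A0 : 0 <= A by rewrite mulr_ge0 ?invr_ge0 ?(ltW p0)// sumr_ge0// => i _;
    exact: sqr_ge0.
  have B0 : 0 <= B by rewrite mulr_ge0 ?invr_ge0 ?(ltW q0)// sumr_ge0// => i _;
    exact: sqr_ge0.
  (* Chain rule for entropy: beyond the entropies inside the blocks, there remains that of the two
     block means [A] and [B]. *)
  have := two_point_entropy p0 q0 (sqrtr_ge0 A) (sqrtr_ge0 B).
  rewrite !sqr_sqrtr//.
  have -> : (p%:R * A + q%:R * B) / (p%:R + q%:R) =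
     (p + q)%:R^-1 * (\sum_(i < p) g i ^+ 2 + \sum_(i < q) g (p + i)%N ^+ 2).
    by rewrite natrD mulrC /A /B !mulVKf ?gt_eqF.
  rewrite natrD.
  have := ler_wpM2l (ltW (addr_gt0 p0 q0)) hs; rewrite [leRHS]mulrA -/c; lra.
- move=> h; rewrite (wE (fun a b => (h a (+) h b)%:R))
    [X in flips X h](_ : _ = (p'.+1 + q')%N); last lia.
  rewrite flipsD !natrD.
  have h1 := w1fl h; have h2 := w2fl (fun i => h (p + i)%N).
  set e1 := (flips p' h)%:R in h1 *; set e2 := (flips q' _)%:R in h2 *.
  set m := (_ (+) _)%:R.
  have e10 : 0 <= e1 :> R by [].
  have e20 : 0 <= e2 :> R by [].
  have m0 : 0 <= m :> R by [].
  have h3 : c * \sum_(a < p) \sum_(b < q) (h a (+) h (p + b)%N)%:R <=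
     (p%:R + q%:R) * (e1 + m + e2).
    rewrite -mulrA ler_wpM2l ?addr_ge0 ?(ltW p0) ?(ltW q0)//.
    rewrite ler_pdivrMl ?mulr_gt0//.
    rewrite -mulrA !mulr_natl.
    rewrite -[X in _ *+ X]card_ord -sumr_const; apply: ler_sum => a _.
    rewrite -[X in _ *+ X]card_ord -sumr_const; apply: ler_sum => b _.
    rewrite /e1 /m /e2 -!natrD ler_nat -flipsD.
    apply: addb_le_flips; last by rewrite leq_add2l -ltnS ltn_ord.
    exact: leq_trans (ltnW (ltn_ord a)) (leq_addr _ _).
  (* The blocks cost [3 p e1] and [3 q e2], at most two thirds of the budget; the remaining [p + q]
     per flip pays for the cross pairs. *)
  have p3' : 3 * p%:R <= 2 * (p%:R + q%:R) :> R by rewrite -natrD -!natrM ler_nat.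
  have q3' : 3 * q%:R <= 2 * (p%:R + q%:R) :> R by rewrite -natrD -!natrM ler_nat.
  have h4 := ler_wpM2r e10 p3'; have h5 := ler_wpM2r e20 q3'.
  have h6 : 0 <= (p%:R + q%:R) * m :> R by rewrite mulr_ge0// -natrD.
  move: h1 h2; rewrite /= -/e1 -/e2.
  lra.
Qed.

(** * Averaging over coordinates *)

Section Mix.
Variables (T : finType) (n : nat).
Implicit Types (S : {set 'I_n}) (x y z : 'rV[T]_n) (i : 'I_n).

Definition mix S x y : 'rV[T]_n := \row_j (if j \in S then y else x) 0 j.

Definition upd x i (a : T) : 'rV[T]_n := mix [set i] x (const_mx a).

Lemma mix0 x y : mix set0 x y = x.
Proof. by apply/rowP => j; rewrite mxE inE. Qed.

Lemma mixT x y : mix setT x y = y.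
Proof. by apply/rowP => j; rewrite mxE in_setT. Qed.

Lemma mixK S x y : mix S (mix S x y) (mix S y x) = x.
Proof. by apply/rowP => j; rewrite !mxE; case: ifP => jS; rewrite mxE jS. Qed.

Lemma mix_mix S S' x y z :
  mix S' (mix S x y) z = mix (S :|: S') x (mix S' y z).
Proof.
apply/rowP => j; rewrite !mxE inE.
by case: ifP => jS'; rewrite ?orbT ?orbF !mxE ?jS'//; case: ifP; rewrite ?mxE ?jS'.
Qed.

Lemma mix_upd S x y i a : i \notin S -> mix S (upd x i a) y = upd (mix S x y) i a.
Proof.
move=> iS; apply/rowP => j; rewrite !mxE !inE.
have [->|ji] := eqVneq j i; first by rewrite (negbTE iS) !mxE inE eqxx mxE.
by case: ifP => jS; rewrite !mxE ?inE ?(negbTE ji) jS.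
Qed.

Lemma mix_upd_in S x y i a : i \in S -> mix S (upd x i a) y = mix S x y.
Proof.
move=> iS; apply/rowP => j; rewrite !mxE.
by case: ifPn => // jS; rewrite mxE inE; case: eqVneq jS => // ->; rewrite iS.
Qed.

Lemma upd_upd x i a b : upd (upd x i a) i b = upd x i b.
Proof.
apply/rowP => j; rewrite !mxE !inE.
by case: (eqVneq j i) => [//|/negbTE ji]; rewrite !mxE ?inE ji.
Qed.

Lemma upd_id x i : upd x i (x 0 i) = x.
Proof. by apply/rowP => j; rewrite !mxE inE; case: eqVneq => [->|_]; rewrite ?mxE. Qed.

Lemma upd_i x i a : upd x i a 0 i = a.
Proof. by rewrite !mxE inE eqxx mxE. Qed.

Lemma upd_j x i a j : j != i -> upd x i a 0 j = x 0 j.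
Proof. by move=> /negbTE ji; rewrite !mxE inE ji. Qed.

Lemma mix1 x y i : mix [set i] x y = upd x i (y 0 i).
Proof.
apply/rowP => j; rewrite !mxE inE; case: eqVneq => [->|//]; by rewrite mxE.
Qed.

Variable V : nmodType.

(** Exchanging the coordinates in [S] between two points is an involution on pairs. *)
Lemma sum_mix_swap S (F : 'rV[T]_n -> 'rV[T]_n -> V) :
  \sum_x \sum_y F (mix S x y) (mix S y x) = \sum_x \sum_y F x y.
Proof.
rewrite (pair_bigA _ (fun x y => F (mix S x y) (mix S y x))).
rewrite (pair_bigA _ (fun x y => F x y))/=.
rewrite [RHS](reindex_inj (h := fun p => (mix S p.1 p.2, mix S p.2 p.1)))//=.
by apply: (can_inj (g := fun p => (mix S p.1 p.2, mix S p.2 p.1))) => -[x y] /=; rewrite !mixK.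
Qed.

(** Exchanging [a] with the [i]-th entry of [x] is an involution on pairs [(x, a)]. *)
Lemma sum_upd i (F : 'rV[T]_n -> V) :
  \sum_x \sum_a F (upd x i a) = (\sum_x F x) *+ #|T|.
Proof.
have -> : (\sum_x F x) *+ #|T| = \sum_x \sum_(a : T) F x.
  by rewrite -sumrMnl; apply: eq_bigr => x _; rewrite sumr_const.
rewrite (pair_bigA _ (fun x a => F (upd x i a))).
rewrite (pair_bigA _ (fun x (a : T) => F x))/=.
rewrite [RHS](reindex_inj (h := fun p => (upd p.1 i p.2, p.1 0 i)))//=.
apply: (can_inj (g := fun p => (upd p.1 i p.2, p.1 0 i))) => -[x a] /=.
by rewrite upd_upd upd_i upd_id.
Qed.

Lemma sum_coord i (G : T -> V) :
  (\sum_(x : 'rV[T]_n) G (x 0 i)) *+ #|T| = (\sum_a G a) *+ #|{: 'rV[T]_n}|.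
Proof.
rewrite -(sum_upd i (fun x : 'rV[T]_n => G (x 0 i))) -sumr_const.
by apply: eq_bigr => x _; apply: eq_bigr => a _; rewrite upd_i.
Qed.

End Mix.

Section Average.
Variables (R : realType) (T : finType) (n : nat).
Implicit Types (S : {set 'I_n}) (x y z : 'rV[T]_n) (i : 'I_n).
Implicit Types (F G : 'rV[T]_n -> R).

Let N : R := #|{: 'rV[T]_n}|%:R.

(** Conditional expectation given the coordinates outside [S]. Summing over full rows [y] repeats
    each choice of the entries in [S] equally often, which [N^-1] compensates. *)
Definition avg S F x : R := N^-1 * \sum_y F (mix S x y).

Lemma card_rV_gt0 x : 0 < N.
Proof. by rewrite ltr0n; apply/card_gt0P; exists x. Qed.

Lemma eq_avg S F G : F =1 G -> avg S F =1 avg S G.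
Proof. by move=> FG x; congr *%R; apply: eq_bigr => y _; rewrite FG. Qed.

Lemma avg0 F x : avg set0 F x = F x.
Proof.
rewrite /avg (eq_bigr (fun _ => F x)) => [|y _]; last by rewrite mix0.
by rewrite sumr_const -mulr_natl mulKf// gt_eqF// card_rV_gt0.
Qed.

Lemma avgT F x : avg setT F x = N^-1 * \sum_y F y.
Proof. by congr *%R; apply: eq_bigr => y _; rewrite mixT. Qed.

Lemma avgB S F G x : avg S (fun z => F z - G z) x = avg S F x - avg S G x.
Proof. by rewrite /avg sumrB mulrBr. Qed.

Lemma avg_cst S c x : avg S (fun=> c) x = c.
Proof. by rewrite /avg sumr_const -mulr_natl mulKf// gt_eqF// card_rV_gt0. Qed.

Lemma ler_avg S F G x : (forall z, F z <= G z) -> avg S F x <= avg S G x.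
Proof.
by move=> FG; apply: ler_wpM2l; [rewrite invr_ge0|apply: ler_sum].
Qed.

Lemma avg_ge0 S F x : (forall z, 0 <= F z) -> 0 <= avg S F x.
Proof. by move=> F0; rewrite -(avg_cst S 0 x) ler_avg. Qed.

Lemma ler_norm_avg S F x : `|avg S F x| <= avg S (fun z => `|F z|) x.
Proof.
by rewrite /avg normrM ger0_norm ?invr_ge0// ler_wpM2l ?invr_ge0// ler_norm_sum.
Qed.

Lemma avg_avg S S' F x : avg S (avg S' F) x = avg (S :|: S') F x.
Proof.
rewrite /avg -mulr_sumr; congr *%R.
transitivity (N^-1 * \sum_y \sum_z F (mix (S :|: S') x (mix S' y z))).
  by congr *%R; apply: eq_bigr => y _; apply: eq_bigr => z _; rewrite mix_mix.
rewrite (sum_mix_swap S' (fun y z => F (mix (S :|: S') x y))).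
under eq_bigr do rewrite sumr_const.
by rewrite sumrMnl -mulr_natl mulKf// gt_eqF// card_rV_gt0.
Qed.

Lemma avg_adj S F G : \sum_x avg S F x * G x = \sum_x F x * avg S G x.
Proof.
have E1 x : avg S F x * G x = N^-1 * \sum_y F (mix S x y) * G x.
  by rewrite /avg -mulrA -mulr_suml.
have E2 x : F x * avg S G x = N^-1 * \sum_y F x * G (mix S x y).
  by rewrite /avg mulrCA -mulr_sumr.
rewrite (eq_bigr _ (fun x _ => E1 x)) (eq_bigr _ (fun x _ => E2 x)).
rewrite -!mulr_sumr; congr *%R.
rewrite -(sum_mix_swap S (fun x y => F x * G (mix S x y))).
by apply: eq_bigr => x _; apply: eq_bigr => y _; rewrite mixK.
Qed.

Lemma sum_avg S F : \sum_x avg S F x = \sum_x F x.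
Proof.
have := avg_adj S F (fun=> 1).
under eq_bigr do rewrite mulr1.
by under [X in _ = X]eq_bigr do rewrite avg_cst mulr1.
Qed.

Lemma sum_avg_sqr S F : \sum_x avg S F x ^+ 2 = \sum_x F x * avg S F x.
Proof.
rewrite (eq_bigr (fun x => avg S F x * avg S F x))// avg_adj.
by apply: eq_bigr => x _; rewrite avg_avg setUid.
Qed.

(** Being self-adjoint and idempotent, [avg S] is an orthogonal projection. *)
Lemma pythagoras S F :
  \sum_x (F x - avg S F x) ^+ 2 = \sum_x F x ^+ 2 - \sum_x avg S F x ^+ 2.
Proof.
have -> : \sum_x (F x - avg S F x) ^+ 2 =
  \sum_x F x ^+ 2 - 2 * (\sum_x F x * avg S F x) + \sum_x avg S F x ^+ 2.
  rewrite mulr_sumr -sumrB -big_split/=.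
  by apply: eq_bigr => x _; ring.
by rewrite -sum_avg_sqr; ring.
Qed.

Lemma avg_upd S F x i a : i \notin S ->
  avg S F (upd x i a) = avg S (fun z => F (upd z i a)) x.
Proof.
by move=> iS; congr *%R; apply: eq_bigr => y _; rewrite mix_upd.
Qed.

Lemma avg_upd_in S F x i a : i \in S -> avg S F (upd x i a) = avg S F x.
Proof.
by move=> iS; congr *%R; apply: eq_bigr => y _; rewrite mix_upd_in.
Qed.

Lemma avg1 F x i : avg [set i] F x = #|T|%:R^-1 * \sum_a F (upd x i a).
Proof.
have T0 : #|T|%:R != 0 :> R by rewrite pnatr_eq0 -lt0n; apply/card_gt0P; exists (x 0 i).
apply: (mulfI T0); rewrite mulVKf// /avg mulrCA.
rewrite (eq_bigr (fun y : 'rV[T]_n => F (upd x i (y 0 i)))) => [|y _]; last by rewrite mix1.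
rewrite mulr_natl (sum_coord i (fun a => F (upd x i a))) -mulr_natl.
by rewrite mulKf// gt_eqF// card_rV_gt0.
Qed.

Lemma sqrt_avg_sub S F G x :
  (Num.sqrt (avg S (fun z => F z ^+ 2) x) -
   Num.sqrt (avg S (fun z => G z ^+ 2) x)) ^+ 2 <=
  avg S (fun z => (F z - G z) ^+ 2) x.
Proof. by apply: sqrt_sum_sub; rewrite invr_ge0. Qed.

End Average.

(** * Dirichlet forms on product spaces *)

Section Dirichlet.
Variables (R : realType) (T : finType) (n : nat) (w : T -> T -> R).
Implicit Types (S : {set 'I_n}) (x y z : 'rV[T]_n) (i j : 'I_n).
Implicit Types (F G : 'rV[T]_n -> R).

Hypothesis T_gt0 : (0 < #|T|)%N.
Hypothesis w_ge0 : forall a b, 0 <= w a b.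
Hypothesis w_log_sobolev : forall g : T -> R,
  \sum_a xlnx (g a ^+ 2) - #|T|%:R * xlnx (#|T|%:R^-1 * \sum_a g a ^+ 2)
  <= \sum_a \sum_b w a b * (g a - g b) ^+ 2.

Let N : R := #|{: 'rV[T]_n}|%:R.

Let N_gt0 : 0 < N.
Proof. by rewrite ltr0n card_mx expn_gt0 T_gt0. Qed.

(** Since [x] ranges over all points, each line in direction [i] is counted [#|T|] times; hence the
    factors [#|T|%:R^-1] below. *)
Definition dirichlet i F : R :=
  \sum_a \sum_b w a b * \sum_x (F (upd x i a) - F (upd x i b)) ^+ 2.

Lemma dirichlet_ge0 i F : 0 <= dirichlet i F.
Proof.
apply: sumr_ge0 => a _; apply: sumr_ge0 => b _; rewrite mulr_ge0// sumr_ge0// => x _.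
exact: sqr_ge0.
Qed.

Lemma log_sobolev_coord i F :
  \sum_x xlnx (F x ^+ 2) - \sum_x xlnx (avg [set i] (fun z => F z ^+ 2) x)
  <= #|T|%:R^-1 * dirichlet i F.
Proof.
have T0 : 0 < #|T|%:R :> R by rewrite ltr0n.
rewrite -(ler_pM2l T0) mulVKf ?gt_eqF// mulrBr.
rewrite [X in X - _]mulr_natl -(sum_upd i (fun x => xlnx (F x ^+ 2))).
have -> : dirichlet i F =
   \sum_x \sum_a \sum_b w a b * (F (upd x i a) - F (upd x i b)) ^+ 2.
  rewrite exchange_big/=; apply: eq_bigr => a _; rewrite exchange_big/=.
  by apply: eq_bigr => b _; rewrite mulr_sumr.
rewrite mulr_sumr -sumrB; apply: ler_sum => x _.
rewrite avg1; exact: (w_log_sobolev (fun a => F (upd x i a))).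
Qed.

(** The root of the average of [F ^+ 2] is a conditional L2 norm, so the reverse triangle inequality
    applies pointwise. *)
Lemma dirichlet_sqrt_avg S i F : i \notin S ->
  dirichlet i (fun x => Num.sqrt (avg S (fun z => F z ^+ 2) x)) <=
  dirichlet i F.
Proof.
move=> iS; apply: ler_sum => a _; apply: ler_sum => b _; rewrite ler_wpM2l//.
rewrite -[leRHS](sum_avg S); apply: ler_sum => x _.
rewrite !avg_upd//; exact: sqrt_avg_sub.
Qed.

(** Tensorisation: coordinates are averaged out one at a time, with [F] replaced by its conditional
    L2 norm [G], whose Dirichlet form in the next direction is no larger. *)
Lemma log_sobolev_seq (s : seq 'I_n) F : uniq s ->
  \sum_x xlnx (F x ^+ 2)
    - \sum_x xlnx (avg [set j in s] (fun z => F z ^+ 2) x)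
  <= #|T|%:R^-1 * \sum_(i <- s) dirichlet i F.
Proof.
elim: s => [_|i s IH /= /andP[is_ us]].
  have -> : [set j : 'I_n in [::]] = set0 by apply/setP => j; rewrite !inE.
  by under [X in _ - X]eq_bigr do rewrite avg0; rewrite subrr big_nil mulr0.
rewrite set_cons big_cons mulrDr addrC.
set S := [set j in s] in IH *; have iS : i \notin S by rewrite inE.
pose G x := Num.sqrt (avg S (fun z => F z ^+ 2) x).
have G2 x : G x ^+ 2 = avg S (fun z => F z ^+ 2) x.
  by rewrite sqr_sqrtr// avg_ge0// => z; exact: sqr_ge0.
have := IH us; have := log_sobolev_coord i G.
have -> : \sum_x xlnx (G x ^+ 2) =
   \sum_x xlnx (avg S (fun z => F z ^+ 2) x) by under eq_bigr do rewrite G2.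
have -> : \sum_x xlnx (avg [set i] (fun z => G z ^+ 2) x) =
   \sum_x xlnx (avg (i |: S) (fun z => F z ^+ 2) x).
  by apply: eq_bigr => x _; rewrite (eq_avg [set i] G2) avg_avg.
have : #|T|%:R^-1 * dirichlet i G <= #|T|%:R^-1 * dirichlet i F.
  by rewrite ler_wpM2l ?invr_ge0// dirichlet_sqrt_avg.
lra.
Qed.

Lemma log_sobolev F :
  \sum_x xlnx (F x ^+ 2) - N * xlnx (N^-1 * \sum_x F x ^+ 2)
  <= #|T|%:R^-1 * \sum_i dirichlet i F.
Proof.
have := log_sobolev_seq F (enum_uniq 'I_n); rewrite big_enum/=.
have -> : [set j in enum 'I_n] = setT by apply/setP => j; rewrite !inE mem_enum.
under [X in _ - X <= _ -> _]eq_bigr do rewrite avgT.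
by rewrite sumr_const mulr_natl.
Qed.

(** For [i = j] the average is constant along the lines, so its form vanishes. Otherwise averaging
    commutes with updating coordinate [i], and Pythagoras applies to each difference. *)
Lemma dirichlet_sub_avg i j F :
  dirichlet i (fun x => F x - avg [set j] F x) =
  dirichlet i F - dirichlet i (avg [set j] F).
Proof.
rewrite /dirichlet -sumrB; apply: eq_bigr => a _; rewrite -sumrB.
apply: eq_bigr => b _; rewrite -mulrBr; congr *%R.
have [->|ij] := eqVneq i j.
  have E x c : avg [set j] F (upd x j c) = avg [set j] F x by rewrite avg_upd_in ?inE.
  rewrite [X in _ = _ - X]big1 => [|x _]; last by rewrite !E subrr expr0n.
  by rewrite subr0; apply: eq_bigr => x _; rewrite !E; congr (_ ^+ 2); ring.
have E x c : avg [set j] F (upd x i c) = avg [set j] (fun z => F (upd z i c)) x.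
  by rewrite avg_upd ?inE.
under [X in _ = _ - X]eq_bigr do rewrite !E -avgB.
rewrite -pythagoras; apply: eq_bigr => x _; rewrite !E avgB; congr (_ ^+ 2); ring.
Qed.

(** As [|d| <= 1], the mean [v] of [d ^+ 2] is at most the mean of [|d|], hence at most
    [expR (- L)]. So [- xlnx v] is at least [L * v], and log-Sobolev bounds it from above up to the
    L1 term. *)
Lemma low_influence_step (L : R) (d : 'rV[T]_n -> R) :
  (forall x, `|d x| <= 1) -> \sum_x `|d x| <= N * expR (- L) ->
  L * \sum_x d x ^+ 2 <=
  #|T|%:R^-1 * (\sum_i dirichlet i d) + 2 * \sum_x `|d x|.
Proof.
move=> d1 dL; set D := _^-1 * _.
set v := N^-1 * \sum_x d x ^+ 2.
have vE : \sum_x d x ^+ 2 = N * v by rewrite mulVKf ?gt_eqF.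
have v0 : 0 <= v.
  by rewrite mulr_ge0 ?invr_ge0 ?(ltW N_gt0)// sumr_ge0// => x _; exact: sqr_ge0.
have vL : v <= expR (- L).
  rewrite -(ler_pM2l N_gt0) -vE; apply: le_trans dL; apply: ler_sum => x _.
  by rewrite -real_normK ?num_real// expr2 ler_piMr.
have := log_sobolev d; rewrite -/v -/D.
have : - 2 * \sum_x `|d x| <= \sum_x xlnx (d x ^+ 2).
  by rewrite mulr_sumr; apply: ler_sum => x _; exact: xlnx_sqr_ge.
suff : L * v <= - xlnx v.
  move=> /(ler_wpM2l (ltW N_gt0)); rewrite vE; lra.
move: v0; rewrite le0r => /predU1P[->|v0]; first by rewrite mulr0 xlnx0 oppr0.
rewrite /xlnx mulrC -mulrN ler_pM2l// lerNr.
by rewrite -[leRHS]expRK ler_ln// posrE expR_gt0.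
Qed.

(* Removing one coordinate at a time lowers the [L^2] norm by that of the
   martingale difference [F - avg [set j] F]; both sides of the step
   inequality telescope. *)
Lemma low_influence_seq (L : R) (s : seq 'I_n) F :
  (forall x, 0 <= F x <= 1) ->
  (forall j, j \in s -> \sum_x `|F x - avg [set j] F x| <= N * expR (- L)) ->
  L * (\sum_x F x ^+ 2 - \sum_x avg [set j in s] F x ^+ 2) <=
  #|T|%:R^-1 * (\sum_i dirichlet i F)
    + 2 * \sum_(j <- s) \sum_x `|F x - avg [set j] F x|.
Proof.
elim: s F => [|j s IH] F F01 Fs.
  have -> : [set j : 'I_n in [::]] = set0 by apply/setP => j; rewrite !inE.
  under [X in _ - X]eq_bigr do rewrite avg0.
  rewrite subrr mulr0 big_nil mulr0 addr0 mulr_ge0 ?invr_ge0// sumr_ge0// => i _.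
  exact: dirichlet_ge0.
pose G := avg [set j] F.
have G01 x : 0 <= G x <= 1.
  rewrite avg_ge0/=; last by move=> z; have /andP[] := F01 z.
  by rewrite -(avg_cst [set j] 1 x) ler_avg// => z; have /andP[] := F01 z.
(* Averaging is an L1 contraction and averages commute, so influences do not grow and the induction
   hypothesis applies to [G]. *)
have GF i : \sum_x `|G x - avg [set i] G x| <= \sum_x `|F x - avg [set i] F x|.
  rewrite -[leRHS](sum_avg [set j]); apply: ler_sum => x _.
  by rewrite avg_avg setUC -avg_avg -avgB ler_norm_avg.
have GL i : i \in s -> \sum_x `|G x - avg [set i] G x| <= N * expR (- L).
  by move=> is_; apply: le_trans (GF i) (Fs i _); rewrite inE is_ orbT.
have := IH G G01 GL.
have -> : \sum_x avg [set i in s] G x ^+ 2 =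
    \sum_x avg [set i in j :: s] F x ^+ 2.
  by apply: eq_bigr => x _; rewrite avg_avg set_cons setUC.
have d1 x : `|F x - G x| <= 1.
  have /andP[? ?] := F01 x; have /andP[? ?] := G01 x.
  by rewrite ler_norml; apply/andP; split; lra.
have := low_influence_step d1 (Fs j (mem_head _ _)).
rewrite pythagoras -/G (eq_bigr _ (fun i _ => dirichlet_sub_avg i j F)).
rewrite sumrB -/G mulrBr big_cons.
have : \sum_(i <- s) \sum_x `|G x - avg [set i] G x| <=
  \sum_(i <- s) \sum_x `|F x - avg [set i] F x| by apply: ler_sum.
lra.
Qed.

End Dirichlet.

(** * Boolean functions *)

Lemma ord_log_sobolev (R : realType) (k : nat) :
  exists w : 'I_k.+1 -> 'I_k.+1 -> R,
  [/\ forall a b, 0 <= w a b,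
      forall g : 'I_k.+1 -> R,
        \sum_a xlnx (g a ^+ 2)
          - #|'I_k.+1|%:R * xlnx (#|'I_k.+1|%:R^-1 * \sum_a g a ^+ 2)
        <= \sum_a \sum_b w a b * (g a - g b) ^+ 2 &
      forall h : 'I_k.+1 -> bool,
        \sum_a \sum_b w a b * (h a (+) h b)%:R
        <= 3 * k.+1%:R * (flips k (fun c => h (inord c)))%:R].
Proof.
have [w [w0 wls wfl]] := @interval_log_sobolev R k.+1 isT.
exists (fun a b => w a b); split=> [//|g|h].
- have := wls (fun c => g (inord c)); rewrite card_ord.
  have E (F : R -> R) : \sum_(i < k.+1) F (g (inord i)) = \sum_a F (g a).
    by apply: eq_bigr => a _; rewrite inord_val.
  rewrite (E (fun u => u ^+ 2)) (E (fun u => xlnx (u ^+ 2))).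
  move=> /le_trans; apply; apply: ler_sum => a _; apply: ler_sum => b _.
  by rewrite !inord_val.
- apply: le_trans (wfl (fun c => h (inord c))).
  by apply: ler_sum => a _; apply: ler_sum => b _; rewrite !inord_val.
Qed.

Section BooleanJunta.
Variables (R : realType) (k n : nat).
Implicit Types (S : {set 'I_n}) (x y : 'rV['I_k.+1]_n) (j : 'I_n).
Implicit Types h : 'rV['I_k.+1]_n -> bool.

(* Up to the normalisation [1 / #|rV|], the expected number of boundary edges
   of [h] on a random line in direction [j]. *)
Definition edges h j : nat :=
  (\sum_(x : 'rV['I_k.+1]_n) flips k (fun c => h (upd x j (inord c))))%N.

Let N : R := #|{: 'rV['I_k.+1]_n}|%:R.

Lemma sqrB_bool (b c : bool) : (b%:R - c%:R) ^+ 2 = (b (+) c)%:R :> R.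
Proof. by case: b; case: c; rewrite /= ?subrr ?subr0 ?sub0r ?sqrrN ?expr1n ?expr0n. Qed.

Lemma addb_le_line_flips h x j a b :
  (h (upd x j a) (+) h (upd x j b)
   <= flips k (fun c => h (upd x j (inord c))))%N.
Proof.
have := @addb_le_flips k a b (fun c => h (upd x j (inord c))).
by rewrite !inord_val; apply; rewrite -ltnS.
Qed.

(** If the value at [x] differs from that at another point of its line, the line contains at least
    one flip. *)
Lemma L1_avg_le_edges h j :
  \sum_x `|(h x)%:R - avg [set j] (fun z => (h z)%:R) x| <= (edges h j)%:R :> R.
Proof.
rewrite /edges natr_sum; apply: ler_sum => x _.
have T0 : 0 < #|'I_k.+1|%:R :> R by rewrite card_ord.
rewrite avg1 -(ler_pM2l T0) -{1}[#|_|%:R]ger0_norm// -normrM mulrBr.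
rewrite mulVKf ?gt_eqF// !mulr_natl -!sumr_const -sumrB.
apply: le_trans (ler_norm_sum _ _ _) _; apply: ler_sum => a _.
rewrite -{1}(upd_id x j); have := addb_le_line_flips h x j (x 0 j) a.
rewrite -(ler_nat R); apply: le_trans.
by case: (h _); case: (h _); rewrite /= ?subrr ?subr0 ?sub0r ?normrN ?normr0 ?normr1.
Qed.

Lemma low_influence_junta h S (L : R) : 0 <= L ->
  (forall j, j \in S -> (edges h j)%:R <= N * expR (- L)) ->
  L * (\sum_x \sum_y (h x (+) h (mix S x y)))%N%:R
  <= 10 * N * (\sum_j edges h j)%N%:R.
Proof.
move=> L0 hS; have [w [w0 wls wfl]] := ord_log_sobolev R k.
have cT : (0 < #|'I_k.+1|)%N by rewrite card_ord.
pose F x : R := (h x)%:R.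
have F01 x : 0 <= F x <= 1 by rewrite /F; case: (h x); rewrite ?lexx ?ler01.
have FS j : j \in enum S -> \sum_x `|F x - avg [set j] F x| <= N * expR (- L).
  by rewrite mem_enum => jS; exact: le_trans (L1_avg_le_edges h j) (hS j jS).
have := low_influence_seq cT w0 wls F01 FS.
have -> : [set j in enum S] = S by apply/setP => j; rewrite !inE mem_enum.
rewrite big_enum/=.
have h1 : \sum_(j in S) \sum_x `|F x - avg [set j] F x| <= (\sum_j edges h j)%N%:R.
  rewrite natr_sum [leRHS](bigID (mem S))/= -[leLHS]addr0 lerD ?sumr_ge0//.
  by apply: ler_sum => j _; exact: L1_avg_le_edges.
have h2 : #|'I_k.+1|%:R^-1 * (\sum_i dirichlet w i F) <= 3 * (\sum_j edges h j)%N%:R.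
  rewrite ler_pdivrMl ?ltr0n// card_ord natr_sum !mulr_sumr.
  apply: ler_sum => i _; rewrite mulrCA mulrA /edges natr_sum mulr_sumr.
  apply: (@le_trans _ _ (\sum_x \sum_a \sum_b w a b * (h (upd x i a) (+) h (upd x i b))%:R)).
    rewrite exchange_big/=; apply: ler_sum => a _; rewrite exchange_big/=.
    apply: ler_sum => b _; rewrite mulr_sumr; apply: ler_sum => x _.
    by rewrite /F sqrB_bool.
  by apply: ler_sum => x _; exact: wfl.
(* The points [x] and [mix S x y] have the same distribution, and the cross term [F * avg S F] sums
   to the squared norm of the average. *)
have -> : (\sum_x \sum_y (h x (+) h (mix S x y)))%N%:R =
  2 * N * (\sum_x F x ^+ 2 - \sum_x avg S F x ^+ 2).
  rewrite sum_avg_sqr natr_sum.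
  transitivity (\sum_x \sum_y (F x ^+ 2 + F (mix S x y) ^+ 2 - 2 * (F x * F (mix S x y)))).
    apply: eq_bigr => x _; rewrite natr_sum; apply: eq_bigr => y _.
    by rewrite -sqrB_bool /F; ring.
  have E1 : \sum_x \sum_y F (mix S x y) ^+ 2 = N * \sum_x F x ^+ 2.
    rewrite (sum_mix_swap S (fun x y => F x ^+ 2)).
    by under eq_bigr do rewrite sumr_const; rewrite sumrMnl mulr_natl.
  have E2 : \sum_x \sum_(y : 'rV['I_k.+1]_n) F x ^+ 2 = N * \sum_x F x ^+ 2.
    by under eq_bigr do rewrite sumr_const; rewrite sumrMnl mulr_natl.
  have E3 : \sum_x \sum_y 2 * (F x * F (mix S x y)) =
      2 * (N * \sum_x F x * avg S F x).
    rewrite !mulr_sumr; apply: eq_bigr => x _; rewrite -mulr_sumr; congr *%R.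
    rewrite mulrCA -mulr_sumr /avg mulVKf ?gt_eqF//; exact: (card_rV_gt0 R x).
  under eq_bigr do rewrite sumrB big_split/=.
  by rewrite sumrB big_split/= E1 E2 E3; ring.
move=> h3; set B := (\sum_j _)%N%:R in h1 h2 *.
(* Here 5 is 3 from the Dirichlet form plus 2 from the L1 term. *)
have h4 : L * (\sum_x F x ^+ 2 - \sum_x avg S F x ^+ 2) <= 5 * B by lra.
have := @ler_wpM2l _ (2 * N) _ _ _ h4.
rewrite mulr_ge0// => /(_ isT); lra.
Qed.

End BooleanJunta.

(** * Half circles *)

Section HalfCircle.
Variable l : nat.
Implicit Types a b d s t : 'I_l.+2.

Definition half_circle a : bool := (a < l.+2./2)%N.

(** The number of rotated half circles separating two points whose difference is [d]. *)
Definition half_diff d : nat := 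
  (\sum_s (half_circle (d + s)%R (+) half_circle s))%N.

Lemma sum_half_circle a b :
  (\sum_t (half_circle (a - t)%R (+) half_circle (b - t)%R))%N =
  half_diff (a - b).
Proof.
rewrite /half_diff (reindex_inj (h := fun s => b - s)) => [|s s' /addrI/oppr_inj//].
by apply: eq_bigr => s _; rewrite !opprB addrA -[a + s - b]addrAC addrCA subrr addr0.
Qed.

Lemma half_diffN d : half_diff (- d) = half_diff d.
Proof.
rewrite /half_diff (reindex_inj (addrI d)); apply: eq_bigr => s _.
by rewrite addKr addbC.
Qed.

Lemma cyc_absE d : @cyc_abs l.+2 d = minn d (l.+2 - d).
Proof. by []. Qed.

Lemma cyc_absN d : @cyc_abs l.+2 (- d) = @cyc_abs l.+2 d.
Proof.
rewrite !cyc_absE/=; have dl := ltn_ord d.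
have [->|d0] := posnP d; first by rewrite subn0 modnn !min0n.
by rewrite modn_small; lia.
Qed.

Lemma sum_interval (n u v : nat) :
  (\sum_(s < n) (u <= s < v))%N = (minn n v - u)%N.
Proof.
elim: n => [|n IH]; first by rewrite big_ord0; lia.
by rewrite big_ord_recr/= IH; case: leqP; case: ltnP => /=; lia.
Qed.

(** A shift by [d] leaves the half circle exactly from the last [d] points of it, giving the lower
    bound. It can enter only from the last [d] points of the whole circle, giving at most [d]
    more. *)
Lemma half_diff_small d : (d <= l.+2./2)%N ->
  (d <= half_diff d <= 2 * d)%N.
Proof.
move=> dl.
have vE s : val (d + s) = (if (d + s < l.+2)%N then (d + s)%N else (d + s - l.+2)%N).
  have sl := ltn_ord s.
  case: ltnP => h; first by rewrite /= modn_small.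
  rewrite /= -{1}(subnK h) modnDr modn_small//.
  by have := ltn_ord d; lia.
have h2l : (l.+2./2.*2 <= l.+2)%N by rewrite -{2}(odd_double_half l.+2) leq_addl.
apply/andP; split.
  apply: (@leq_trans (\sum_(s < l.+2) (l.+2./2 - d <= s < l.+2./2))).
    by rewrite sum_interval; lia.
  apply: leq_sum => s _; rewrite /half_circle vE.
  have sl := ltn_ord s.
  case: (ltnP s) => sh; case: (leqP (_ - _) s) => //= ds.
  by case: (ltnP (d + s)) => // h1; case: ltnP => //=; lia.
apply: (@leq_trans (\sum_(s < l.+2) (l.+2./2 - d <= s < l.+2./2) +
   \sum_(s < l.+2) (l.+2 - d <= s < l.+2))%N).
  rewrite -big_split/=; apply: leq_sum => s _; rewrite /half_circle vE.
  have sl := ltn_ord s.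
  case: (ltnP (d + s) l.+2) => h1; case: (ltnP s); case: ltnP; case: leqP;
    by case: leqP; case: ltnP => /=; lia.
rewrite !sum_interval; lia.
Qed.

Lemma half_diff_bounds d : (@cyc_abs l.+2 d <= half_diff d <= 2 * @cyc_abs l.+2 d)%N.
Proof.
have dl := ltn_ord d.
have h2l : (l.+2 <= l.+2./2.*2.+1)%N.
  by rewrite -{1}(odd_double_half l.+2); case: (odd _) => /=; lia.
have [h|h] := leqP d l.+2./2.
  have -> : @cyc_abs l.+2 d = d by rewrite cyc_absE; lia.
  exact: half_diff_small.
have vE : val (- d) = (l.+2 - d)%N.
  by rewrite /= modn_small; lia.
rewrite -half_diffN.
have -> : @cyc_abs l.+2 d = val (- d) by rewrite vE cyc_absE; lia.
by apply: half_diff_small; rewrite vE; lia.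
Qed.

Lemma cyc_abs_le d : (@cyc_abs l.+2 d <= l.+2)%N.
Proof. by rewrite cyc_absE; lia. Qed.

End HalfCircle.

(** * Functions of small variation *)

Section Junta.
Variables (R : realType) (k n l : nat).
Implicit Types (S : {set 'I_n}) (x y : 'rV['I_k.+1]_n) (j : 'I_n).
Implicit Types h : 'rV['I_k.+1]_n -> 'I_l.+2.

Let N : R := #|{: 'rV['I_k.+1]_n}|%:R.

Let N_gt0 : 0 < N.
Proof. exact: (card_rV_gt0 R (const_mx ord0 : 'rV['I_k.+1]_n)). Qed.

(** Only the path edges from [c] to [c.+1] are summed, not the edge closing the cycle. Each line is
    counted once for each of its points. *)
Definition variation h : nat :=
  (\sum_j \sum_(x : 'rV['I_k.+1]_n) \sum_(c < k)
    @cyc_abs l.+2 (h (upd x j (inord c)) - h (upd x j (inord c.+1)))%R)%N.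

Definition half_of h (t : 'I_l.+2) x : bool := half_circle (h x - t).

Lemma sum_edges_half h :
  (\sum_t \sum_j edges (half_of h t) j <= 2 * variation h)%N.
Proof.
rewrite exchange_big/= /variation big_distrr/=; apply: leq_sum => j _.
rewrite exchange_big/= big_distrr/=; apply: leq_sum => x _.
rewrite exchange_big/= big_distrr/=; apply: leq_sum => c _.
rewrite sum_half_circle.
by have /andP[] := half_diff_bounds (h (upd x j (inord c)) - h (upd x j (inord c.+1))).
Qed.

Lemma cyc_abs_le_half h x y :
  (@cyc_abs l.+2 (h x - h y)%R <= \sum_t (half_of h t x (+) half_of h t y))%N.
Proof. by rewrite sum_half_circle; have /andP[] := half_diff_bounds (h x - h y). Qed.

Lemma le_expR (u : R) : u <= expR u.
Proof. by have := expR_ge1Dx u; lra. Qed.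

(** The set [J] collects the coordinates that are influential for some half circle. Freezing all
    others at a suitable point [y] gives the junta. *)
Lemma junta_of_variation h (V eps : R) : 0 < V -> 0 < eps ->
  (variation h)%:R <= N * V ->
  exists J : {set 'I_n}, #|J|%:R <= l.+2%:R * expR (22 * V / eps) /\
  exists g : 'rV['I_k.+1]_n -> 'I_l.+2,
    (forall x y, {in J, forall j, x 0 j = y 0 j} -> g x = g y) /\
    \sum_x (@cyc_abs l.+2 (h x - g x))%:R <= N * eps.
Proof.
move=> V0 eps0 hV.
(* A constant suffices when [eps] is at least the diameter bound; the other case supplies
   [eps < l.+2], used in bounding [#|J|]. *)
have [epsl|epsl] := leP l.+2%:R eps.
  exists set0; rewrite cards0; split; first by rewrite mulr_ge0 ?expR_ge0.
  exists (fun=> 0); split=> //; rewrite mulr_natl -sumr_const.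
  apply: ler_sum => x _; apply: le_trans epsl; rewrite ler_nat; exact: cyc_abs_le.
(* Chosen so that [10 * N * (2 * (N * V))] equals [L * (N * (N * eps))]. *)
pose L := 20 * V / eps.
have L0 : 0 < L by rewrite divr_gt0 ?mulr_gt0.
pose thr := N * expR (- L).
have thr0 : 0 < thr by rewrite mulr_gt0 ?expR_gt0.
pose J := [set j | [exists t, thr < (edges (half_of h t) j)%:R]].
have hE : (\sum_t \sum_j edges (half_of h t) j)%N%:R <= 2 * (N * V) :> R.
  have := sum_edges_half h; rewrite -(ler_nat R) natrM => /le_trans; apply.
  by rewrite ler_pM2l.
exists J; split.
  have h1 : #|J|%:R * thr <= 2 * (N * V).
    apply: le_trans hE; rewrite exchange_big/= natr_sum [leRHS](bigID (mem J))/=.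
    rewrite -[leLHS]addr0 lerD ?sumr_ge0// mulr_natl -sumr_const.
    apply: ler_sum => j; rewrite inE => /existsP[t /ltW /le_trans]; apply.
    by rewrite ler_nat (bigD1 t)//= leq_addr.
  have h2 : #|J|%:R <= 2 * V * expR L.
    rewrite -(ler_pM2r thr0); apply: le_trans h1 _.
    rewrite /thr [leRHS](_ : _ = 2 * (N * V) * (expR L * expR (- L))); last by ring.
    by rewrite -expRD subrr expR0 mulr1.
  apply: le_trans h2 _.
  (* The extra 2 over the 20 in [L] absorbs the prefactor: [2 * V] is [eps * (2 * V / eps)], at most
     [l.+2%:R * expR (2 * V / eps)]. *)
  have -> : 22 * V / eps = 2 * V / eps + L by rewrite /L; field; rewrite gt_eqF.
  rewrite expRD mulrA ler_pM2r ?expR_gt0//.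
  rewrite [leLHS](_ : _ = eps * (2 * V / eps)); last by field; rewrite gt_eqF.
  apply: ler_pM; rewrite ?le_expR// ?ltW//.
  by rewrite divr_gt0 ?mulr_gt0.
pose S := ~: J.
have hS t j : j \in S -> (edges (half_of h t) j)%:R <= thr.
  by rewrite !inE negb_exists => /forallP/(_ t); rewrite -leNgt.
pose D x y : nat := @cyc_abs l.+2 (h x - h (mix S x y)).
have hD : \sum_y \sum_x (D x y)%:R <= N * (N * eps).
  rewrite -(ler_pM2l L0).
  have -> : L * (N * (N * eps)) = 10 * N * (2 * (N * V)).
    by rewrite /L; field; rewrite gt_eqF.
  have h10 : 0 <= 10 * N by rewrite mulr_ge0.
  apply: le_trans (ler_wpM2l h10 hE).
  rewrite [in leRHS]natr_sum [leRHS]mulr_sumr.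
  apply: (@le_trans _ _ (\sum_t L * (\sum_x \sum_y
      (half_of h t x (+) half_of h t (mix S x y)))%N%:R)); last first.
    by apply: ler_sum => t _; apply: low_influence_junta (ltW L0) (hS t).
  rewrite -mulr_sumr ler_pM2l// exchange_big/= -[leRHS]natr_sum.
  rewrite [in leRHS]exchange_big/= natr_sum.
  apply: ler_sum => x _; rewrite [in leRHS]exchange_big/= natr_sum; apply: ler_sum => y _.
  rewrite ler_nat; exact: cyc_abs_le_half.
(* By averaging over [y], some frozen point has at most the mean error. *)
have [/existsP[y hy]|/existsPn hN] := boolP [exists y, \sum_x (D x y)%:R <= N * eps].
  exists (fun x => h (mix S x y)); split=> // x x' xx'.
  congr h; apply/rowP => j; rewrite !mxE; case: ifPn => // jS.
  by rewrite xx'//; move: jS; rewrite inE negbK.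
move: hD; rewrite leNgt mulr_natl -sumr_const ltr_sum//.
  by apply/hasP; exists (const_mx ord0) => //; rewrite mem_index_enum.
by move=> y _; rewrite ltNge hN.
Qed.

End Junta.

(** * Lipschitz maps *)

(** A junta prescribes the exact size of its set, so the sets found for different [i] must be
    enlarged to a common size. *)
Lemma subset_extend (T : finType) (M : nat) (J : {set T}) :
  (#|J| <= M <= #|T|)%N -> exists2 J' : {set T}, J \subset J' & #|J'| = M.
Proof.
elim: M => [|M IH]; first by rewrite leqn0 => /andP[/eqP J0 _]; exists J.
rewrite leq_eqVlt => /andP[/predU1P[JM _|JM MT]]; first by exists J.
have [|J' JJ' J'M] := IH; first by rewrite -ltnS JM ltnW.
have /set0Pn[i iJ'] : ~: J' != set0.
  by rewrite -card_gt0 cardsCs setCK subn_gt0 J'M.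
exists (i |: J'); first exact: subset_trans JJ' (subsetU1 _ _).
by rewrite cardsU1 J'M; move: iJ'; rewrite inE => ->.
Qed.

Lemma rowB (V : zmodType) (n : nat) (x y : 'rV[V]_n) i :
  (x - y) 0 i = x 0 i - y 0 i.
Proof. by rewrite !mxE. Qed.

Lemma norm1_upd_step (R : realType) (k n : nat) (x : 'rV['I_k.+2]_n) j c :
  (c < k.+1)%N ->
  @norm1 R k.+2 n (upd x j (inord c) - upd x j (inord c.+1)) = n%:R^-1.
Proof.
move=> ck; rewrite /norm1 (bigD1 j)//= big1 => [|i ij]; last first.
  by rewrite rowB !upd_j// subrr cyc_absE min0n.
rewrite rowB !upd_i.
suff -> : @cyc_abs k.+2 (inord c - inord c.+1) = 1%N by rewrite addr0 mulr1.
have -> : inord c - inord c.+1 = - 1 :> 'I_k.+2.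
  have -> : inord c.+1 = inord c + 1 :> 'I_k.+2.
    by apply/val_inj; rewrite /= !inordK ?modn_small//; lia.
  by rewrite opprD addrA subrr add0r.
rewrite cyc_absN cyc_absE /= modn_small//; lia.
Qed.

(** Each edge has normalised length [1 / n], so the cyclic distances over all [m] coordinates sum to
    at most [m * alpha / n] on it. The [k.+1] edges per line are rounded up to [k.+2]. *)
Lemma sum_variation (R : realType) (k l n m : nat) (alpha : R)
    (f : 'rV['I_k.+2]_n -> 'rV['I_l.+2]_m) : (0 < n)%N -> (0 < m)%N ->
    0 <= alpha -> @lipschitz1 R k.+2 l.+2 n m alpha f ->
  \sum_i (variation (fun x => f x 0 i))%:R <=
  #|{: 'rV['I_k.+2]_n}|%:R * (m%:R * alpha * k.+2%:R).
Proof.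
move=> n0 m0 a0 fl.
have nN0 : n%:R != 0 :> R by rewrite pnatr_eq0 -lt0n.
have mN0 : m%:R != 0 :> R by rewrite pnatr_eq0 -lt0n.
rewrite -natr_sum /variation exchange_big/= natr_sum.
apply: (@le_trans _ _ (\sum_(j < n) \sum_(x : 'rV['I_k.+2]_n) \sum_(c < k.+1)
    m%:R * alpha / n%:R)).
  apply: ler_sum => j _; rewrite exchange_big/= natr_sum.
  apply: ler_sum => x _; rewrite exchange_big/= natr_sum.
  apply: ler_sum => c _.
  have := fl (upd x j (inord c)) (upd x j (inord c.+1)).
  rewrite norm1_upd_step// /norm1 ler_pdivrMl ?ltr0n// mulrA natr_sum.
  by apply: le_trans; apply: ler_sum => i _; rewrite (rowB (f _)).
under eq_bigr do under eq_bigr do rewrite sumr_const card_ord -mulr_natl.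
under eq_bigr do rewrite sumr_const -mulr_natl.
rewrite sumr_const card_ord -[leLHS]mulr_natl.
set N := #|_|%:R.
rewrite [leLHS](_ : _ = N * (m%:R * alpha * k.+1%:R)); last by field.
by rewrite ler_wpM2l// ler_wpM2l ?mulr_ge0// ler_nat.
Qed.

Theorem theorem4 (R : realType) :
  exists C2 : R, 0 < C2 /\
    forall (k l n m : nat) (alpha : R) (f : 'rV['Z_k]_n -> 'rV['Z_l]_m),
      (2 <= k)%N -> (2 <= l)%N -> (1 <= n)%N -> (1 <= m)%N ->
      0 < alpha -> lipschitz1 alpha f ->
      forall delta eps : R, 0 < delta -> 0 < eps ->
        exists M : nat,
          M%:R <= l%:R * expR (C2 * alpha * k%:R / (delta * eps)) /\
          exists I : {set 'I_m},
            (1 - delta) * m%:R <= #|I|%:R /\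
            forall i, i \in I ->
              exists g : 'rV['Z_k]_n -> 'Z_l,
                junta M g /\ eps_close eps (fun x => f x 0 i) g.
Proof.
(* Destructing [k] and [l] makes ['Z_k] and ['Z_l] convertible to the ordinal types of the previous
   lemmas. *)
exists 22; split=> // -[|[|k]]// [|[|l]]// n m alpha f _ _ n0 m0 alpha0 fl.
move=> delta eps delta0 eps0.
set N : R := #|{: 'rV['I_k.+2]_n}|%:R.
have N0 : 0 < N by exact: (card_rV_gt0 R (const_mx ord0 : 'rV['I_k.+2]_n)).
pose V := alpha * k.+2%:R / delta.
have V0 : 0 < V by rewrite divr_gt0 ?mulr_gt0.
pose var i := @variation k.+1 n l (fun x => f x 0 i).
pose I : {set 'I_m} := [set i | (var i)%:R <= N * V].
set B := _ * expR _.
have BE : B = l.+2%:R * expR (22 * V / eps).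
  by rewrite /B /V; congr (_ * expR _); field; rewrite !gt_eqF.
have B0 : 0 <= B by rewrite mulr_ge0 ?expR_ge0.
have /fin_all_exists[J hJ] : forall i, exists J : {set 'I_n}, i \in I ->
    #|J|%:R <= B /\ exists g : 'rV['I_k.+2]_n -> 'I_l.+2,
      (forall x y : 'rV['I_k.+2]_n, {in J, forall j, x 0 j = y 0 j} -> g x = g y) /\
      \sum_x (@cyc_abs l.+2 (f x 0 i - g x))%:R <= N * eps.
  move=> i; have [|] := boolP (i \in I); last by exists set0.
  rewrite inE => /(junta_of_variation V0 eps0)[J]; rewrite -BE => hJ.
  by exists J.
(* One [M] must serve every [i] in [I]; for empty [I] it is 0, whence [B0]. *)
exists (\max_(i in I) #|J i|); split.
  apply: (big_ind (fun M : nat => M%:R <= B)) => // [a b aB bB|i iI].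
    by rewrite /maxn; case: ifP.
  by have [] := hJ i iI.
exists I; split.
  have := sum_variation n0 m0 (ltW alpha0) fl; rewrite -/N -/var => hs.
  (* Markov's inequality: every index outside [I] contributes more than [N * V]. *)
  have h1 : (m%:R - #|I|%:R) * (N * V) <= N * (m%:R * alpha * k.+2%:R).
    apply: le_trans hs; rewrite [leRHS](bigID (mem I))/= -[leLHS]add0r.
    rewrite lerD ?sumr_ge0//.
    have -> : m%:R - #|I|%:R = #|~: I|%:R :> R.
      by rewrite -[m in m%:R]card_ord -(cardsC I) natrD addrC addKr.
    rewrite mulr_natl -sumr_const big_mkcond [leRHS]big_mkcond/=.
    apply: ler_sum => i _; rewrite !inE; case: ifPn => //.
    by rewrite -ltNge => /ltW.
  have NV0 : 0 < N * V by rewrite mulr_gt0.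
  have h2 : N * (m%:R * alpha * k.+2%:R) = delta * m%:R * (N * V).
    by rewrite /V; field; rewrite gt_eqF.
  move: h1; rewrite h2 ler_pM2r//; lra.
move=> i iI; have [_ [g [gJ gc]]] := hJ i iI.
have [|J' JJ' J'M] := @subset_extend _ (\max_(i in I) #|J i|) (J i).
  rewrite (leq_bigmax_cond (F := fun i => #|J i|))//=.
  by apply/bigmax_leqP => i' _; exact: max_card.
exists g; split.
  exists J'; split=> // x y xy; apply: gJ => j jJ; apply: xy.
  exact: (subsetP JJ').
rewrite /eps_close -natrX ler_pdivrMl ?ltr0n ?expn_gt0//.
by move: gc; rewrite /N card_mx card_ord mul1n.
Qed.
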